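(* Let $A$ and $B$ be two associative unital algebras over a field $k$, and let $R:B\otimes A\rightarrow A\otimes B$ and $Q:A\otimes B\rightarrow A\otimes B$ be two linear maps, with notation $R(b\otimes a)=a_R\otimes b_R$ and $Q(a\otimes b)=a_Q\otimes b_Q$ for all $a\in A$, $b\in B$, satisfying the following conditions for all $a,a'\in A$ and $b,b'\in B$: \begin{align*} & a_R\otimes 1_R=a\otimes 1,\qquad 1_R\otimes b_R=1\otimes b,\\ & (aa')_R\otimes b_R=a_Ra'_r\otimes b_{R_r},\\ & a_R\otimes (bb')_R=a_{R_r}\otimes b_rb'_R,\\ & a_Q\otimes 1_Q=a\otimes 1,\qquad 1_Q\otimes b_Q=1\otimes b,\\ & (aa')_Q\otimes b_Q=a_qa'_Q\otimes b_{Q_q},\\ & a_Q\otimes (bb')_Q=a_{Q_q}\otimes b_Qb'_q,\\ & b_R\otimes a_{R_Q}\otimes b'_Q=b_R\otimes a_{Q_R}\otimes b'_Q,\\ & a_R\otimes b_{R_Q}\otimes a'_Q=a_R\otimes b_{Q_R}\otimes a'_Q, \end{align*} where $r$ (respectively $q$) is another copy of $R$ (respectively $Q$). Define on $A\otimes B$ a multiplication by $$(a\otimes b)(a'\otimes b')=a_Qa'_R\otimes b_Rb'_Q .$$ Then this multiplication is associative and $1\otimes 1$ is its unit.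
   Context: All algebras, linear maps and tensor products are over a field $k$ ($\otimes=\otimes_k$); algebras are associative and unital. The notation $R(b\otimes a)=a_R\otimes b_R$, $Q(a\otimes b)=a_Q\otimes b_Q$ is a Sweedler-type notation with implicit summation. Letters $r$, $q$ denote further independent copies of $R$, $Q$. Nested subscripts mean successive application, the subscript closest to the letter being applied first: $a_{R_Q}=(a_R)_Q$. For example, $a_Ra'_r\otimes b_{R_r}$ is computed by first forming $R(b\otimes a)=a_R\otimes b_R$ and then $R(b_R\otimes a')=a'_r\otimes (b_R)_r$; $a_qa'_Q\otimes b_{Q_q}$ is computed by first forming $Q(a'\otimes b)=a'_Q\otimes b_Q$ and then $Q(a\otimes b_Q)=a_q\otimes (b_Q)_q$; in $b_R\otimes a_{R_Q}\otimes b'_Q$ one first forms $R(b\otimes a)$ and then applies $Q$ to $a_R\otimes b'$; in $a_R\otimes b_{Q_R}\otimes a'_Q$ one first forms $Q(a'\otimes b)=a'_Q\otimes b_Q$ and then $R(b_Q\otimes a)$. In the defining formula of the multiplication, $a_Q\otimes b'_Q=Q(a\otimes b')$ and $a'_R\otimes b_R=R(b\otimes a')$. The algebra so obtained is denoted $A\;_Q\otimes_R B$ and is called the L-R-twisted tensor product of $A$ and $B$ afforded by $R$ and $Q$. *)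

(* Defs.v *)
From HB Require Import structures.
From mathcomp Require Import all_boot all_order all_algebra.
From mathcomp Require Import boolp.
From mathcomp.multinomials Require Import freeg.

Set Implicit Arguments.
Unset Strict Implicit.
Unset Printing Implicit Defensive.

Import GRing.Theory.
Import Quotient.Exports.

Local Open Scope ring_scope.
Local Open Scope quotient_scope.

(* Associative unital algebras.  The library's [algType] requires [1 != 0] and *)
(* is built without a [pzRingType] counterpart to which one could be joined.   *)
(* The structure below also covers the zero algebra; every [algType] is an     *)
(* instance, with [amul] and [aone] convertible to [*%R] and [1].              *)
HB.mixin Record isUnitalAlg (R : pzRingType) A of GRing.Lmodule R A := {
  amul : A -> A -> A;
  aone : A;
  amulA : associative amul;
  amul1l : left_id aone amul;
  amul1r : right_id aone amul;
  amulDl : left_distributive amul +%R;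
  amulDr : right_distributive amul +%R;
  amulZl : forall (c : R) (x y : A), amul (c *: x) y = c *: amul x y;
  amulZr : forall (c : R) (x y : A), amul x (c *: y) = c *: amul x y
}.

#[short(type="unitalAlgType")]
HB.structure Definition UnitalAlg (R : pzRingType) :=
  {A of GRing.Lmodule R A & isUnitalAlg R A}.

Arguments aone {R A} : rename.

Notation "x ** y" := (amul x y)
  (at level 40, left associativity) : ring_scope.

HB.instance Definition _ (R : pzRingType) (A : algType R) :=
  isUnitalAlg.Build R (GRing.Algebra.sort A)
    (@mulrA A) (@mul1r A) (@mulr1 A) (@mulrDl A) (@mulrDr A)
    (fun c x y => esym (scalerAl c x y)) (fun c x y => esym (scalerAr c x y)).

(* The tensor product of two vector spaces, as the quotient of the free vector *)
(* space on U * V by the subspace generated by the bilinearity relations.      *)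
Section TensorProduct.
Variables (k : fieldType) (U V : lmodType k).

Let F := {freeg (U * V)%type / k}.
Let e (u : U) (v : V) : F := << (u, v) >>.

Inductive tensor_rel : F -> Prop :=
| tensor_rel_Dl u u' v : tensor_rel (e (u + u') v - (e u v + e u' v))
| tensor_rel_Dr u v v' : tensor_rel (e u (v + v') - (e u v + e u v'))
| tensor_rel_Zl c u v : tensor_rel (e (c *: u) v - c *: e u v)
| tensor_rel_Zr c u v : tensor_rel (e u (c *: v) - c *: e u v)
| tensor_rel0 : tensor_rel 0
| tensor_relD x y : tensor_rel x -> tensor_rel y -> tensor_rel (x + y)
| tensor_relZ c x : tensor_rel x -> tensor_rel (c *: x).

Definition tensor_relb : pred F := fun x => `[< tensor_rel x >].

Fact tensor_relb_zmod_closed : zmod_closed tensor_relb.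
Proof.
split=> [|x y /asboolP Sx /asboolP Sy]; apply/asboolP.
  exact: tensor_rel0.
by apply: tensor_relD => //; rewrite -scaleN1r; apply: tensor_relZ.
Qed.

HB.instance Definition _ :=
  GRing.isZmodClosed.Build F tensor_relb tensor_relb_zmod_closed.

Definition tensor_rels : zmodClosed F := GRing.ZmodClosed.clone F tensor_relb _.

Definition tensor : Type := Quotient.quot tensor_rels.

HB.instance Definition _ := Choice.on tensor.
HB.instance Definition _ := GRing.Zmodule.on tensor.

Let p (x : F) : tensor := \pi_(Quotient.quot tensor_rels) x.

Local Lemma pB x y : p (x - y) = p x - p y.
Proof. exact: (raddfB (\pi_(Quotient.quot tensor_rels))). Qed.
Local Lemma pD x y : p (x + y) = p x + p y.
Proof. exact: (raddfD (\pi_(Quotient.quot tensor_rels))). Qed.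

Local Lemma p_eq x y : (p x = p y) <-> tensor_rel (x - y).
Proof.
have -> : tensor_rel (x - y) <-> x - y \in tensor_rels.
  by split=> [xy|/asboolP //]; apply/asboolP.
by rewrite Quotient.idealrBE; split=> /eqP.
Qed.

Local Lemma pK (t : tensor) : p (repr t) = t.
Proof. exact: reprK. Qed.

Definition tensor_scale (c : k) (t : tensor) : tensor := p (c *: repr t).

Local Lemma pZ c x : tensor_scale c (p x) = p (c *: x).
Proof.
apply/p_eq; rewrite -scalerBr; apply: tensor_relZ.
by apply/p_eq; rewrite pK.
Qed.

Fact tensor_scalerA a b t :
  tensor_scale a (tensor_scale b t) = tensor_scale (a * b) t.
Proof. by rewrite -[t]pK !pZ scalerA. Qed.
Fact tensor_scale1r t : tensor_scale 1 t = t.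
Proof. by rewrite -[t]pK pZ scale1r. Qed.
Fact tensor_scalerDr c : {morph tensor_scale c : x y / x + y}.
Proof.
by move=> x y; rewrite -[x]pK -[y]pK -pD !pZ -pD scalerDr.
Qed.
Fact tensor_scalerDl t : {morph tensor_scale^~ t : a b / a + b}.
Proof. by move=> a b; rewrite -[t]pK !pZ -pD scalerDl. Qed.

HB.instance Definition _ := GRing.Zmodule_isLmodule.Build k tensor
  tensor_scalerA tensor_scale1r tensor_scalerDr tensor_scalerDl.

Definition tens (u : U) (v : V) : tensor := p (e u v).

Lemma tensDl u u' v : tens (u + u') v = tens u v + tens u' v.
Proof. by rewrite /tens -pD; apply/p_eq/tensor_rel_Dl. Qed.
Lemma tensDr u v v' : tens u (v + v') = tens u v + tens u v'.
Proof. by rewrite /tens -pD; apply/p_eq/tensor_rel_Dr. Qed.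
Lemma tensZl c u v : tens (c *: u) v = c *: tens u v.
Proof. by rewrite /tens [RHS]pZ; apply/p_eq/tensor_rel_Zl. Qed.
Lemma tensZr c u v : tens u (c *: v) = c *: tens u v.
Proof. by rewrite /tens [RHS]pZ; apply/p_eq/tensor_rel_Zr. Qed.

Lemma tens_bilinear : bilinear_for *:%R *:%R tens.
Proof.
by split=> [v c x y|u c x y]; rewrite ?(tensDl, tensDr) ?(tensZl, tensZr).
Qed.

Lemma tensor_ind (P : tensor -> Prop) :
  (forall u v, P (tens u v)) -> (forall s t, P s -> P t -> P (s + t)) ->
  forall t, P t.
Proof.
move=> Pt PD t; rewrite -[t]pK -[repr t]freeg_sumE.
elim: (dom _) => [|[u v] d IH].
  rewrite big_nil; suff -> : p 0 = tens 0 0 by [].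
  by rewrite -[0 in RHS](scale0r 0) tensZl [RHS]pZ scale0r.
rewrite big_cons pD; apply: (PD _ _ _ IH).
suff -> : p << coeff (u, v) (repr t) *g (u, v) >> =
          tens (coeff (u, v) (repr t) *: u) v by [].
rewrite tensZl [RHS]pZ; congr p; apply/eqP/freeg_eqP => z.
by rewrite coeffZ !coeffU mul1r.
Qed.

End TensorProduct.

Notation "u \ox v" := (tens u v) (at level 40, left associativity) : ring_scope.

(* The linear map out of U (x) V induced by a bilinear f, evaluated at t.  It  *)
(* is computed on a chosen representative of t, hence is meaningful only when  *)
(* f is bilinear; see [tlift_tens] and [tlift_linear].                         *)
Definition tlift (k : fieldType) (U V W : lmodType k) (f : U -> V -> W)
    (t : tensor U V) : W :=
  fglift (fun z : U * V => f z.1 z.2) (repr t).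

(* Sweedler notation: if t is the sum of the u_i \ox v_i, this is the sum of   *)
(* the E[u_i/u, v_i/v], for E bilinear in (u, v).                              *)
Notation "\sw_ ( u \ox v <- t ) E" := (tlift (fun u v => E) t)
  (at level 41, E at level 41, u name, v name, t at level 200,
   format "'[' \sw_ ( u  \ox  v  <-  t ) '/  '  E ']'") : ring_scope.

Section TensorLift.
Variables (k : fieldType) (U V W : lmodType k).
Variable f : U -> V -> W.
Hypothesis f_bilinear : bilinear_for *:%R *:%R f.

Let g (z : U * V) : W := f z.1 z.2.

Local Lemma fgliftD x y : fglift g (x + y) = fglift g x + fglift g y.
Proof.
have fgB := lift_is_additive (M := W) g.
have fg0 : fglift g 0 = 0 by rewrite -(subrr 0) fgB subrr.
have fgN z : fglift g (- z) = - fglift g z by rewrite -sub0r fgB fg0 sub0r.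
by rewrite -{1}[y]opprK fgB fgN opprK.
Qed.

Local Lemma fgliftB x y : fglift g (x - y) = fglift g x - fglift g y.
Proof. exact: (lift_is_additive (M := W) g). Qed.

Local Lemma fglift0 : fglift g 0 = 0.
Proof. by rewrite -(subrr 0) fgliftB subrr. Qed.

Local Lemma fgliftZ c x : fglift g (c *: x) = c *: fglift g x.
Proof.
rewrite -[x]freeg_sumE; elim: (dom _) => [|z d IH].
  by rewrite big_nil scaler0 fglift0 scaler0.
rewrite big_cons scalerDr !fgliftD IH scalerDr; congr (_ + _).
have -> : c *: << coeff z x *g z >> = << c * coeff z x *g z >>.
  by apply/eqP/freeg_eqP => y; rewrite coeffZ !coeffU mulrA.
by rewrite !liftU scalerA.
Qed.

Local Lemma fglift_rel x : tensor_rel x -> fglift g x = 0.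
Proof.
have fl v : linear (f^~ v) := f_bilinear.1 v.
have fr u : linear (f u) := f_bilinear.2 u.
have fDl u u' v : f (u + u') v = f u v + f u' v.
  by have := fl v 1 u u'; rewrite !scale1r.
have fDr u v v' : f u (v + v') = f u v + f u v'.
  by have := fr u 1 v v'; rewrite !scale1r.
have f0l v : f 0 v = 0 by apply: (@addIr _ (f 0 v)); rewrite -fDl !add0r.
have f0r u : f u 0 = 0 by apply: (@addIr _ (f u 0)); rewrite -fDr !add0r.
have fZl c u v : f (c *: u) v = c *: f u v.
  by have := fl v c u 0; rewrite f0l !addr0.
have fZr c u v : f u (c *: v) = c *: f u v.
  by have := fr u c v 0; rewrite f0r !addr0.
elim=> {x} [u u' v|u v v'|c u v|c u v||x y _ IHx _ IHy|c x _ IH].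
- by rewrite fgliftB fgliftD !liftU !scale1r /g /= fDl subrr.
- by rewrite fgliftB fgliftD !liftU !scale1r /g /= fDr subrr.
- by rewrite fgliftB fgliftZ !liftU !scale1r /g /= fZl subrr.
- by rewrite fgliftB fgliftZ !liftU !scale1r /g /= fZr subrr.
- exact: fglift0.
- by rewrite fgliftD IHx IHy addr0.
- by rewrite fgliftZ IH scaler0.
Qed.

Local Lemma tlift_pi (x : {freeg (U * V)%type / k}) (t : tensor U V) :
  t = \pi_(Quotient.quot (@tensor_rels k U V)) x ->
  tlift f t = fglift g x.
Proof.
move=> tx; apply/eqP; rewrite -subr_eq0 -fgliftB; apply/eqP/fglift_rel/p_eq.
by rewrite pK tx.
Qed.

Lemma tlift_tens u v : tlift f (u \ox v) = f u v.
Proof. by rewrite (tlift_pi erefl) liftU scale1r. Qed.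

Lemma tlift_linear : linear (tlift f).
Proof.
move=> c s t; rewrite (@tlift_pi (c *: repr s + repr t)).
  by rewrite fgliftD fgliftZ.
by apply: etrans (esym (pD _ _)); rewrite -pZ !pK.
Qed.

End TensorLift.

Lemma tlift_unique (k : fieldType) (U V W : lmodType k) (f : U -> V -> W)
    (h : {linear tensor U V -> W}) :
  (forall u v, h (u \ox v) = f u v) -> h =1 tlift f.
Proof.
move=> hf; have fb : bilinear_for *:%R *:%R f.
  by split=> [v|u] c x y; rewrite /= -!hf
    ?(tensDl, tensDr) ?(tensZl, tensZr) linearP.
elim/tensor_ind => [u v|s t IHs IHt]; first by rewrite tlift_tens.
by rewrite linearD IHs IHt -[s]scale1r tlift_linear // !scale1r.
Qed.

Section TensorLiftComb.
Variables (k : fieldType).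

Lemma tlift_comb (U V W : lmodType k) (f g h : U -> V -> W) c t :
  (forall u v, h u v = c *: f u v + g u v) ->
  tlift h t = c *: tlift f t + tlift g t.
Proof.
move=> hE; rewrite /tlift -[repr t]freeg_repr !fglift_Freeg /prelift.
rewrite scaler_sumr -big_split; apply: eq_bigr => z _ /=.
by rewrite hE scalerDr !scalerA mulrC.
Qed.

Lemma eq_tlift (U V W : lmodType k) (f g : U -> V -> W) t :
  (forall u v, f u v = g u v) -> tlift f t = tlift g t.
Proof.
move=> fg; rewrite /tlift -[repr t]freeg_repr !fglift_Freeg.
by apply: eq_bigr => z _; rewrite fg.
Qed.

Lemma tlift_swap_linear (U V U' V' W : lmodType k)
    (f : U -> V -> U' -> V' -> W) (t : tensor U' V') :
  (forall u' v', bilinear_for *:%R *:%R (fun u v => f u v u' v')) ->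
  bilinear_for *:%R *:%R (fun u v => \sw_(u' \ox v' <- t) f u v u' v').
Proof.
move=> fb; split=> [v c x y|u c x y]; apply: tlift_comb => u' v'.
  exact: (fb u' v').1.
exact: (fb u' v').2.
Qed.

End TensorLiftComb.

Section LRmul.
Variables (k : fieldType) (A B : unitalAlgType k).
Variable R : {linear tensor B A -> tensor A B}.
Variable Q : {linear tensor A B -> tensor A B}.

Definition LRmul (s t : tensor A B) : tensor A B :=
  \sw_(a \ox b <- s) \sw_(a' \ox b' <- t)
    \sw_(aQ \ox b'Q <- Q (a \ox b')) \sw_(a'R \ox bR <- R (b \ox a'))
      (aQ ** a'R) \ox (bR ** b'Q).

Let comb (p q : tensor A B) : tensor A B :=
  \sw_(x \ox v <- p) \sw_(u \ox y <- q) (x ** u) \ox (y ** v).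

Local Lemma comb_inner x v : bilinear_for *:%R *:%R
  (fun (u : A) (y : B) => (x ** u) \ox (y ** v)).
Proof.
split=> [y|u] c z z' /=.
  by rewrite amulDr amulZr tensDl tensZl.
by rewrite amulDl amulZl tensDr tensZr.
Qed.

Local Lemma comb_bilinear : bilinear_for *:%R *:%R comb.
Proof.
split=> [q c p p'|p c q q'].
  apply: tlift_linear; apply: tlift_swap_linear => u y.
  split=> [v|x] d z z' /=.
    by rewrite amulDl amulZl tensDl tensZl.
  by rewrite amulDr amulZr tensDr tensZr.
by apply: tlift_comb => x v; rewrite tlift_linear //; apply: comb_inner.
Qed.

Local Lemma combP a b a' b' : comb (Q (a \ox b')) (R (b \ox a')) =
  \sw_(aQ \ox b'Q <- Q (a \ox b')) \sw_(a'R \ox bR <- R (b \ox a'))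
      (aQ ** a'R) \ox (bR ** b'Q).
Proof. by []. Qed.

Local Lemma LRmul_left a' b' : bilinear_for *:%R *:%R
  (fun a b => comb (Q (a \ox b')) (R (b \ox a'))).
Proof.
split=> [b|a] c x y /=.
  by rewrite tensDl tensZl linearP comb_bilinear.1.
by rewrite tensDl tensZl linearP comb_bilinear.2.
Qed.

Local Lemma LRmul_right a b : bilinear_for *:%R *:%R
  (fun a' b' => comb (Q (a \ox b')) (R (b \ox a'))).
Proof.
split=> [b'|a'] c x y /=.
  by rewrite tensDr tensZr linearP comb_bilinear.2.
by rewrite tensDr tensZr linearP comb_bilinear.1.
Qed.

Lemma LRmul_bilinear : bilinear_for *:%R *:%R LRmul.
Proof.
split=> [t c s s'|s c t t'].
  apply: tlift_linear; apply: tlift_swap_linear; exact: LRmul_left.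
by apply: tlift_comb => a b; apply: tlift_linear; apply: LRmul_right.
Qed.

Lemma LRmul_tens a b a' b' :
  LRmul (a \ox b) (a' \ox b') =
    \sw_(aQ \ox b'Q <- Q (a \ox b')) \sw_(a'R \ox bR <- R (b \ox a'))
      (aQ ** a'R) \ox (bR ** b'Q).
Proof.
rewrite /LRmul tlift_tens; last first.
  by apply: tlift_swap_linear; apply: LRmul_left.
by rewrite tlift_tens //; apply: LRmul_right.
Qed.

End LRmul.

(* Main.v *)
Require Import Defs.
From HB Require Import structures.
From mathcomp Require Import all_boot all_order all_algebra.
From mathcomp.multinomials Require Import freeg.

Import GRing.Theory.

Local Open Scope ring_scope.

(* On simple tensors both bracketings of a triple product expand, by the       *)
(* multiplicativity of R and Q, into a sum over six twists.  They differ only  *)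
(* in the order in which R and Q act on the middle factors a' and b', and the  *)
(* two mixed compatibilities exchange these orders.                            *)

(** In [((a ⊗ b)(a' ⊗ b'))(a'' ⊗ b'')] the factor [a'] meets [R] (with [b]) before [Q] (with [b'']),
    and [b'] meets [Q] (with [a]) before [R] (with [a'']); the other bracketing reverses both
    orders. [RQ_BAB] on [b, a', b''] and [RQ_ABA] on [a'', a, b'] reverse them back, and sums over
    independent tensors commute. [LRmul_mul_tens] and [LRmul_tens_mul] give the two expansions;
    [tlift_sw3] lets an identity in a triple tensor product act inside a nested sum. For the unit,
    [R] and [Q] merely transpose or fix a tensor with a factor 1, so the defining sums collapse. *)

Section SweedlerSums.
Context {k : fieldType}.
Implicit Types U V W X Y Z : lmodType k.

Lemma linear_add {U V} {h : U -> V} :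
  linear h -> forall x y, h (x + y) = h x + h y.
Proof. by move=> hL x y; rewrite -{1}[x]scale1r hL scale1r. Qed.

Lemma linear_sum_scale {U V} {h : U -> V} {I : Type} (s : seq I) (c : I -> k)
    (f : I -> U) :
  linear h -> h (\sum_(i <- s) c i *: f i) = \sum_(i <- s) c i *: h (f i).
Proof.
move=> hL; have h0 : h 0 = 0.
  by apply: (@addIr _ (h 0)); rewrite -{1}[h 0]scale1r -hL scaler0 !add0r.
by elim: s => [|i s IH]; rewrite ?big_nil // !big_cons hL IH.
Qed.

(* The representative of [t] is fixed, so the rules drawn from this formula    *)
(* for exchanging sums hold without bilinearity of the summands.               *)
Lemma tliftE {U V W} (f : U -> V -> W) t :
  tlift f t = \sum_(z <- repr (repr t)) z.1 *: f z.2.1 z.2.2.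
Proof. by rewrite /tlift -{1}[repr t]freeg_repr fglift_Freeg. Qed.

Lemma tlift_exchange {U V U' V' W} (f : U -> V -> U' -> V' -> W) s t :
  \sw_(u \ox v <- s) \sw_(u' \ox v' <- t) f u v u' v' =
  \sw_(u' \ox v' <- t) \sw_(u \ox v <- s) f u v u' v'.
Proof.
rewrite !tliftE; under eq_bigr do rewrite tliftE scaler_sumr.
under [RHS]eq_bigr do rewrite tliftE scaler_sumr.
rewrite exchange_big; apply: eq_bigr => i _; apply: eq_bigr => j _.
by rewrite !scalerA mulrC.
Qed.

Lemma linear_tlift {U V W W'} {h : W -> W'} {f : U -> V -> W} {t} :
  linear h -> h (tlift f t) = \sw_(u \ox v <- t) h (f u v).
Proof. by move=> hL; rewrite !tliftE linear_sum_scale. Qed.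

(** The parameter sits in the summand and [t] is fixed, so linearity in it suffices. When it sits in
    the tensor, as in [linear_tlift_arg], the representative changes and bilinearity of the summand
    is needed. *)
Lemma linear_tlift_body {U V W X} (f : X -> U -> V -> W) t :
  (forall u v, linear (fun x => f x u v)) ->
  linear (fun x => \sw_(u \ox v <- t) f x u v).
Proof. by move=> fL c x y; apply: tlift_comb => u v; apply: fL. Qed.

Lemma linear_tlift_arg {U V W X} (f : U -> V -> W)
    (T : X -> tensor U V) :
  bilinear_for *:%R *:%R f -> linear T -> linear (fun x => tlift f (T x)).
Proof. by move=> fB TL c x y; rewrite TL tlift_linear. Qed.

(** Presents both conditions as explicit abstractions, the shape on which [multilinear] matches. *)
Lemma bilinear_intro {U V W} (f : U -> V -> W) :
  (forall v, linear (fun u => f u v)) -> (forall u, linear (fun v => f u v)) ->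
  bilinear_for *:%R *:%R f.
Proof. by []. Qed.

Lemma linear_tensl {U V X} (f : X -> U) (v : V) :
  linear f -> linear (fun x => f x \ox v).
Proof. by move=> fL c x y; rewrite fL tensDl tensZl. Qed.

Lemma linear_tensr {U V X} (u : U) (f : X -> V) :
  linear f -> linear (fun x => u \ox f x).
Proof. by move=> fL c x y; rewrite fL tensDr tensZr. Qed.

Lemma linear_amull {A : unitalAlgType k} {X} (f : X -> A) (y : A) :
  linear f -> linear (fun x => f x ** y).
Proof. by move=> fL c x z; rewrite fL amulDl amulZl. Qed.

Lemma linear_amulr {A : unitalAlgType k} {X} (y : A) (f : X -> A) :
  linear f -> linear (fun x => y ** f x).
Proof. by move=> fL c x z; rewrite fL amulDr amulZr. Qed.

Lemma linear_app {U V X} (h : {linear U -> V}) (f : X -> U) :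
  linear f -> linear (fun x => h (f x)).
Proof. by move=> fL c x z; rewrite fL linearP. Qed.

Lemma linear_idfun {X} : linear (fun x : X => x).
Proof. by []. Qed.

Lemma tlift_sw2 {U V U1 V1 U2 V2 W : lmodType k}
    {f : U -> V -> W} {p : U1 -> V1 -> U2 -> V2 -> U}
    {q : U1 -> V1 -> U2 -> V2 -> V} {s : tensor U1 V1}
    {T : U1 -> V1 -> tensor U2 V2} :
  bilinear_for *:%R *:%R f ->
  tlift f (\sw_(u \ox v <- s) \sw_(u' \ox v' <- T u v)
      p u v u' v' \ox q u v u' v') =
  \sw_(u \ox v <- s) \sw_(u' \ox v' <- T u v)
      f (p u v u' v') (q u v u' v').
Proof.
move=> fB; have fL := tlift_linear fB.
rewrite linear_tlift //; apply: eq_tlift => u v.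
by rewrite linear_tlift //; apply: eq_tlift => u' v'; rewrite tlift_tens.
Qed.

(** Read from right to left, this views a nested sum as a trilinear map evaluated at one element of
    [(X ⊗ Y) ⊗ Z], where [RQ_BAB] or [RQ_ABA] can be rewritten. *)
Lemma tlift_sw3 {X Y Z U1 V1 U2 V2 W : lmodType k}
    {f : X -> Y -> Z -> W} {p : U1 -> V1 -> U2 -> V2 -> X}
    {q : U1 -> V1 -> U2 -> V2 -> Y} {r : U1 -> V1 -> U2 -> V2 -> Z}
    {s : tensor U1 V1} {T : U1 -> V1 -> tensor U2 V2} :
  (forall z, bilinear_for *:%R *:%R (fun x y => f x y z)) ->
  (forall x y, linear (f x y)) ->
  \sw_(xy \ox z <- \sw_(u \ox v <- s) \sw_(u' \ox v' <- T u v)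
      (p u v u' v' \ox q u v u' v') \ox r u v u' v')
    \sw_(x \ox y <- xy) f x y z =
  \sw_(u \ox v <- s) \sw_(u' \ox v' <- T u v)
      f (p u v u' v') (q u v u' v') (r u v u' v').
Proof.
move=> fB fL; rewrite tlift_sw2; last first.
  apply: bilinear_intro => [z|xy]; first exact: tlift_linear.
  by apply: linear_tlift_body => x y; apply: fL.
by apply: eq_tlift => u v; apply: eq_tlift => u' v'; rewrite tlift_tens.
Qed.

End SweedlerSums.

(** In the expressions treated here the variable occurs once, so each rule descends towards that
    occurrence. *)
Ltac multilinear := cbv beta; lazymatch goal with
  | |- forall _, _ => intro; multilinear
  | |- bilinear_for _ _ _ => apply: bilinear_intro; multilinear
  | |- linear (fun x => x) => exact: linear_idfun
  | |- linear (fun x => GRing.Linear.sort _ _) => apply: linear_app; multilinear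
  | |- _ => first
      [ apply: linear_tlift_body | apply: linear_tlift_arg
      | apply: linear_tensl | apply: linear_tensr
      | apply: linear_amull | apply: linear_amulr]; multilinear
  end.

Section LRtwisted.
Variables (k : fieldType) (A B : unitalAlgType k).
Variable R : {linear tensor B A -> tensor A B}.
Variable Q : {linear tensor A B -> tensor A B}.

Lemma LRmul_assoc_tens :
  (forall a b a' b' a'' b'',
    LRmul R Q (a \ox b) (LRmul R Q (a' \ox b') (a'' \ox b'')) =
    LRmul R Q (LRmul R Q (a \ox b) (a' \ox b')) (a'' \ox b'')) ->
  associative (LRmul R Q).
Proof.
move=> mA; have [mL mR] := LRmul_bilinear R Q.
have mDl s s' t : LRmul R Q (s + s') t = LRmul R Q s t + LRmul R Q s' t.
  exact: linear_add (mL t) s s'.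
have mDr s t t' : LRmul R Q s (t + t') = LRmul R Q s t + LRmul R Q s t'.
  exact: linear_add (mR s) t t'.
elim/tensor_ind => [a b|s s' IH IH'] t w; last by rewrite !mDl IH IH'.
elim/tensor_ind: t => [a' b'|t t' IH IH']; last by rewrite mDl !mDr mDl IH IH'.
elim/tensor_ind: w => [a'' b''|w w' IH IH']; last by rewrite !mDr IH IH'.
exact: mA.
Qed.

(** The products [aQ ** a'R] and [bR ** b'Q] enter the outer multiplication as left factors, hence
    the use of [Q_mulA] and [R_mulB]. *)
Lemma LRmul_mul_tens
    (R_mulB : forall (a : A) (b b' : B),
      R ((b ** b') \ox a) =
        \sw_(aR \ox b'R <- R (b' \ox a)) \sw_(aRr \ox br <- R (b \ox aR))
          aRr \ox (br ** b'R))
    (Q_mulA : forall (a a' : A) (b : B),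
      Q ((a ** a') \ox b) =
        \sw_(a'Q \ox bQ <- Q (a' \ox b)) \sw_(aq \ox bQq <- Q (a \ox bQ))
          (aq ** a'Q) \ox bQq) a b a' b' a'' b'' :
  LRmul R Q (LRmul R Q (a \ox b) (a' \ox b')) (a'' \ox b'') =
  \sw_(aQ \ox b'Q <- Q (a \ox b')) \sw_(a'R \ox bR <- R (b \ox a'))
    \sw_(a'Rq \ox b''q <- Q (a'R \ox b'')) \sw_(aQq \ox b''qq <- Q (aQ \ox b''q))
      \sw_(a''r \ox b'Qr <- R (b'Q \ox a'')) \sw_(a''rr \ox bRr <- R (bR \ox a''r))
        (aQq ** a'Rq ** a''rr) \ox (bRr ** b'Qr ** b''qq).
Proof.
have mL := (LRmul_bilinear R Q).1 (a'' \ox b'').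
rewrite LRmul_tens (linear_tlift mL).
apply: eq_tlift => aQ b'Q.
rewrite (linear_tlift mL).
apply: eq_tlift => a'R bR.
rewrite LRmul_tens Q_mulA R_mulB tlift_sw2; last by multilinear.
apply: eq_tlift => a'Rq b''q; apply: eq_tlift => aQq b''qq.
by rewrite tlift_sw2; last by multilinear.
Qed.

Lemma LRmul_tens_mul
    (R_mulA : forall (a a' : A) (b : B),
      R (b \ox (a ** a')) =
        \sw_(aR \ox bR <- R (b \ox a)) \sw_(a'r \ox bRr <- R (bR \ox a'))
          (aR ** a'r) \ox bRr)
    (Q_mulB : forall (a : A) (b b' : B),
      Q (a \ox (b ** b')) =
        \sw_(aQ \ox bQ <- Q (a \ox b)) \sw_(aQq \ox b'q <- Q (aQ \ox b'))
          aQq \ox (bQ ** b'q)) a b a' b' a'' b'' :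
  LRmul R Q (a \ox b) (LRmul R Q (a' \ox b') (a'' \ox b'')) =
  \sw_(a'Q \ox b''Q <- Q (a' \ox b'')) \sw_(a''R \ox b'R <- R (b' \ox a''))
    \sw_(aq \ox b'Rq <- Q (a \ox b'R)) \sw_(aqq \ox b''Qq <- Q (aq \ox b''Q))
      \sw_(a'Qr \ox br <- R (b \ox a'Q)) \sw_(a''Rr \ox brr <- R (br \ox a''R))
        (aqq ** a'Qr ** a''Rr) \ox (brr ** b'Rq ** b''Qq).
Proof.
have mR := (LRmul_bilinear R Q).2 (a \ox b).
rewrite LRmul_tens (linear_tlift mR); apply: eq_tlift => a'Q b''Q.
rewrite (linear_tlift mR); apply: eq_tlift => a''R b'R.
rewrite LRmul_tens Q_mulB R_mulA tlift_sw2; last by multilinear.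
apply: eq_tlift => aq b'Rq; apply: eq_tlift => aqq b''Qq.
rewrite tlift_sw2; last by multilinear.
(* Reassociating gives the summand the same shape as in [LRmul_mul_tens]. *)
by apply: eq_tlift => ? ?; apply: eq_tlift => ? ?; rewrite !amulA.
Qed.

End LRtwisted.

Theorem proposition2p1 (k : fieldType) (A B : unitalAlgType k)
    (R : {linear tensor B A -> tensor A B})
    (Q : {linear tensor A B -> tensor A B})
    (R_unitB : forall a : A, R (aone \ox a) = a \ox aone)
    (R_unitA : forall b : B, R (b \ox aone) = aone \ox b)
    (R_mulA : forall (a a' : A) (b : B),
      R (b \ox (a ** a')) =
        \sw_(aR \ox bR <- R (b \ox a)) \sw_(a'r \ox bRr <- R (bR \ox a'))
          (aR ** a'r) \ox bRr)
    (R_mulB : forall (a : A) (b b' : B),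
      R ((b ** b') \ox a) =
        \sw_(aR \ox b'R <- R (b' \ox a)) \sw_(aRr \ox br <- R (b \ox aR))
          aRr \ox (br ** b'R))
    (Q_unitB : forall a : A, Q (a \ox aone) = a \ox aone)
    (Q_unitA : forall b : B, Q (aone \ox b) = aone \ox b)
    (Q_mulA : forall (a a' : A) (b : B),
      Q ((a ** a') \ox b) =
        \sw_(a'Q \ox bQ <- Q (a' \ox b)) \sw_(aq \ox bQq <- Q (a \ox bQ))
          (aq ** a'Q) \ox bQq)
    (Q_mulB : forall (a : A) (b b' : B),
      Q (a \ox (b ** b')) =
        \sw_(aQ \ox bQ <- Q (a \ox b)) \sw_(aQq \ox b'q <- Q (aQ \ox b'))
          aQq \ox (bQ ** b'q))
    (RQ_BAB : forall (a : A) (b b' : B),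
      \sw_(aR \ox bR <- R (b \ox a)) \sw_(aRQ \ox b'Q <- Q (aR \ox b'))
        (bR \ox aRQ) \ox b'Q =
      \sw_(aQ \ox b'Q <- Q (a \ox b')) \sw_(aQR \ox bR <- R (b \ox aQ))
        (bR \ox aQR) \ox b'Q)
    (RQ_ABA : forall (a a' : A) (b : B),
      \sw_(aR \ox bR <- R (b \ox a)) \sw_(a'Q \ox bRQ <- Q (a' \ox bR))
        (aR \ox bRQ) \ox a'Q =
      \sw_(a'Q \ox bQ <- Q (a' \ox b)) \sw_(aR \ox bQR <- R (bQ \ox a))
        (aR \ox bQR) \ox a'Q) :
  [/\ associative (LRmul R Q),
      left_id (aone \ox aone) (LRmul R Q) &
      right_id (aone \ox aone) (LRmul R Q)].
Proof.
split.
- apply: LRmul_assoc_tens => a b a' b' a'' b''.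
  rewrite LRmul_mul_tens // LRmul_tens_mul //; symmetry.
  (* For fixed [aQ] and [b'Q], the two twists of [a'] are gathered into one tensor so that [RQ_BAB]
     puts [Q] before [R]. *)
  under eq_tlift => aQ b'Q.
    rewrite -(tlift_sw3 (f := fun bR a'Rq b''q =>
      \sw_(aQq \ox b''qq <- Q (aQ \ox b''q))
      \sw_(a''r \ox b'Qr <- R (b'Q \ox a''))
      \sw_(a''rr \ox bRr <- R (bR \ox a''r))
        (aQq ** a'Rq ** a''rr) \ox (bRr ** b'Qr ** b''qq))); [|multilinear..].
    rewrite RQ_BAB tlift_sw3; [|multilinear..].
    over.
  (* Now [Q (a' \ox b'')] depends on no other twist and moves outermost, as in the other
     expansion. *)
  rewrite tlift_exchange; apply: eq_tlift => a'Q b''Q.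
  (* The twists of b' are brought together so that [RQ_ABA] applies.           *)
  transitivity (\sw_(a'Qr \ox br <- R (b \ox a'Q))
     \sw_(a''R \ox b'R <- R (b' \ox a''))
     \sw_(aq \ox b'Rq <- Q (a \ox b'R)) \sw_(aqq \ox b''Qq <- Q (aq \ox b''Q))
      \sw_(a''Rr \ox brr <- R (br \ox a''R))
        (aqq ** a'Qr ** a''Rr) \ox (brr ** b'Rq ** b''Qq)).
    rewrite tlift_exchange; apply: eq_tlift => a'Qr br.
    under eq_tlift => aq b'q do rewrite tlift_exchange.
    pose f a''R b'Rq aq := \sw_(aqq \ox b''Qq <- Q (aq \ox b''Q))
      \sw_(a''Rr \ox brr <- R (br \ox a''R))
        (aqq ** a'Qr ** a''Rr) \ox (brr ** b'Rq ** b''Qq).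
    have fB aq : bilinear_for *:%R *:%R (fun a''R b'Rq => f a''R b'Rq aq).
      by rewrite /f; multilinear.
    have fL a''R b'Rq : linear (f a''R b'Rq) by rewrite /f; multilinear.
    by rewrite -(tlift_sw3 fB fL) -RQ_ABA tlift_sw3.
  (* Only the place of the sum over [R (b \ox a'Q)] still differs; it moves inwards past three sums
     independent of it. *)
  rewrite tlift_exchange; apply: eq_tlift => a''R b'R.
  rewrite tlift_exchange; apply: eq_tlift => aq b'Rq.
  by rewrite tlift_exchange.
- have [_ mR] := LRmul_bilinear R Q.
  elim/tensor_ind => [a b|s t IHs IHt]; last first.
    by rewrite (linear_add (mR _)) IHs IHt.
  rewrite LRmul_tens Q_unitA R_unitB tlift_tens; last by multilinear.
  by rewrite tlift_tens ?amul1l //; multilinear.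
- have [mL _] := LRmul_bilinear R Q.
  elim/tensor_ind => [a b|s t IHs IHt]; last first.
    by rewrite (linear_add (mL _)) IHs IHt.
  rewrite LRmul_tens Q_unitB R_unitA tlift_tens; last by multilinear.
  by rewrite tlift_tens ?amul1r //; multilinear.
Qed.
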